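(* Consider private information retrieval with private side information under a storage constraint, as described in the context, with $N\ge 1$ databases, $K$ messages, cache size $S$, and a caching scheme consisting of $M$ accessed messages with cached fractions $r_1,\dots,r_M\in[0,1]$, $\sum_{i=1}^M r_i=S$, indexed so that $r_1\ge r_2\ge\dots\ge r_M$. Then the optimal normalized download cost is $$D^*=1+\frac{1}{N}+\frac{1}{N^2}+\dots+\frac{1}{N^{K-1-M}}+\frac{1-r_M}{N^{K-M}}+\frac{1-r_{M-1}}{N^{K-M+1}}+\dots+\frac{1-r_1}{N^{K-1}}.$$
   Context: Model (PIR-PSI under a storage constraint). There are $N$ non-communicating databases, each storing the same $K$ independent messages $W_1,\dots,W_K$, each of $L$ symbols: $H(W_1)=\dots=H(W_K)=L$ and $H(W_1,\dots,W_K)=\sum_k H(W_k)$. The user has a cache of $SL$ symbols, $S\in[0,K]$. Prefetching phase: the user picks a random index set $\mathbb{H}\subset[K]$ with $|\mathbb{H}|=M$, $S\le M\le K$, and for the $i$-th accessed message ($i=1,\dots,M$) caches its first $Lr_i$ symbols, where $\sum_{i=1}^M r_i=S$; the cached content is denoted $\mathcal{W}_\mathbb{H}$. The databases know $M$ and $(r_1,\dots,r_M)$ (the caching scheme) but not $\mathbb{H}$. Retrieval phase: the user privately picks a desired index $\theta\in[K]$, with $H(\theta,\mathbb{H},W_1,\dots,W_K)=H(\theta)+H(\mathbb{H})+\sum_k H(W_k)$. It sends queries $Q_1^{[\theta,\mathbb{H}]},\dots,Q_N^{[\theta,\mathbb{H}]}$ independent of the messages: $I(W_1,\dots,W_K;Q_1^{[\theta,\mathbb{H}]},\dots,Q_N^{[\theta,\mathbb{H}]})=0$.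 Database $n$ returns an answer $A_n^{[\theta,\mathbb{H}]}$ that is a deterministic function of $Q_n^{[\theta,\mathbb{H}]}$ and $W_1,\dots,W_K$. Reliability: $H(W_\theta\mid \mathcal{W}_\mathbb{H},\mathbb{H},Q_{1:N}^{[\theta,\mathbb{H}]},A_{1:N}^{[\theta,\mathbb{H}]})=o(L)$, where $o(L)/L\to0$ as $L\to\infty$. Privacy: for every $n\in[N]$, all $\theta,\theta'\in[K]$ and all $\mathbb{H},\mathbb{H}'\subset[K]$ with $|\mathbb{H}|=|\mathbb{H}'|=M$, $(Q_n^{[\theta,\mathbb{H}]},A_n^{[\theta,\mathbb{H}]},W_1,\dots,W_K)$ and $(Q_n^{[\theta',\mathbb{H}']},A_n^{[\theta',\mathbb{H}']},W_1,\dots,W_K)$ are identically distributed. A pair $(D,L)$ is achievable if such a scheme exists for messages of $L$ symbols with download $D=\sum_{n=1}^N H(A_n^{[\theta,\mathbb{H}]})$. The optimal normalized download cost is $D^*=\inf\{D/L:(D,L)\text{ achievable}\}$. *)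

(* Defs.v *)
From HB Require Import structures.
From mathcomp Require Import all_boot all_order all_algebra.
From mathcomp Require Import all_classical all_reals all_analysis.
Set Implicit Arguments. Unset Strict Implicit. Unset Printing Implicit Defensive.
Import Order.TTheory GRing.Theory Num.Theory numFieldNormedType.Exports.
Local Open Scope ring_scope.
Local Open Scope classical_set_scope.

Section PIRPSI.
Variable R : realType.

Definition prob_of {T : finType} {U : eqType} (P : T -> R) (f : T -> U) (u : U) : R :=
  \sum_(t : T | f t == u) P t.

(* Shannon entropy (in nats) of the random variable f under P:
   H(f) = - sum_u p_u ln p_u = - sum_t P t ln p_{f t}. *)
Definition ent {T : finType} {U : eqType} (P : T -> R) (f : T -> U) : R :=
  - \sum_(t : T) P t * ln (prob_of P f (f t)).

Definition cent {T : finType} {U V : eqType} (P : T -> R) (f : T -> U) (g : T -> V) : R :=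
  ent P (fun t => (f t, g t)) - ent P g.

Definition msgs (K L q : nat) := {ffun 'I_K -> {ffun 'I_L -> 'I_q}}.

(* A retrieval scheme for N databases, K messages of L q-ary symbols and
   caching schemes with M accessed messages.  The prefetch index set H is
   given as an injective map 'I_M -> 'I_K (the i-th accessed message is H i).
   [qdist th H] is the conditional distribution of the query vector
   (Q_1,...,Q_N) given (theta, H); it does not depend on the messages
   (queries independent of messages).  Database n answers
   [ans n Q_n W], a deterministic function of its query and the messages. *)
Record scheme (N K M L q : nat) : Type := Scheme {
  Qt : finType;
  At : finType;
  qdist : 'I_K -> {ffun 'I_M -> 'I_K} -> {ffun 'I_N -> Qt} -> R;
  ans : 'I_N -> Qt -> msgs K L q -> At
}.
Arguments Qt {N K M L q} s.
Arguments At {N K M L q} s.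
Arguments qdist {N K M L q} s _ _ _.
Arguments ans {N K M L q} s _ _ _.

Section Scheme.
Variables (N K M L q : nat) (r : 'I_M -> R) (sch : scheme N K M L q).

Definition sample := (msgs K L q * {ffun 'I_N -> Qt sch})%type.

(* Joint distribution of (W_1..W_K, Q_1..Q_N) given theta and H:
   messages i.i.d. uniform (so H(W_k) = L q-ary units), independent of queries. *)
Definition jointP (th : 'I_K) (H : {ffun 'I_M -> 'I_K}) (t : sample) : R :=
  ((q ^ (K * L))%:R)^-1 * qdist sch th H t.2.

Definition ncache (i : 'I_M) : nat := Num.truncn (L%:R * r i).

Definition cache (H : {ffun 'I_M -> 'I_K}) (t : sample) : {ffun 'I_M -> seq 'I_q} :=
  [ffun i => take (ncache i) (fgraph (t.1 (H i)))].

Definition answer (n : 'I_N) (t : sample) : At sch := ans sch n (t.2 n) t.1.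

Definition answers (t : sample) : {ffun 'I_N -> At sch} := [ffun n => answer n t].

Definition valid_qdist : Prop :=
  forall th (H : {ffun 'I_M -> 'I_K}), injectiveb H ->
    (forall Q, 0 <= qdist sch th H Q) /\ \sum_Q qdist sch th H Q = 1.

Definition private : Prop :=
  forall (n : 'I_N) th th' (H H' : {ffun 'I_M -> 'I_K}),
    injectiveb H -> injectiveb H' ->
    forall (x : Qt sch * At sch * msgs K L q),
      prob_of (jointP th H) (fun t => (t.2 n, answer n t, t.1)) x =
      prob_of (jointP th' H') (fun t => (t.2 n, answer n t, t.1)) x.

Definition decoding_error (th : 'I_K) (H : {ffun 'I_M -> 'I_K}) : R :=
  cent (jointP th H) (fun t => t.1 th) (fun t => (cache H t, t.2, answers t)).

Definition download (th : 'I_K) (H : {ffun 'I_M -> 'I_K}) : R :=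
  \sum_(n < N) ent (jointP th H) (answer n).

End Scheme.

(* A normalized download cost d is achievable if there is a sequence of
   valid, private schemes with message lengths L_j -> oo, whose decoding
   error is o(L_j) and whose normalized download D/L_j tends to d
   (entropies measured in q-ary units, i.e. nats / ln q). *)
Definition achievable (N K M : nat) (r : 'I_M -> R) (d : R) : Prop :=
  exists (Ls qs : nat -> nat) (sch : forall j, scheme N K M (Ls j) (qs j)),
    (forall j, (2 <= qs j)%N) /\
    (forall B : nat, exists j0, forall j, (j0 <= j)%N -> (B <= Ls j)%N) /\
    (forall j, valid_qdist (sch j)) /\
    (forall j, private (sch j)) /\
    (forall th (H : {ffun 'I_M -> 'I_K}), injectiveb H ->
       ((fun j => decoding_error r (sch j) th H / ((Ls j)%:R * ln (qs j)%:R)) @ \oo --> 0) /\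
       ((fun j => download (sch j) th H / ((Ls j)%:R * ln (qs j)%:R)) @ \oo --> d)).

Definition Dstar (N K M : nat) (r : 'I_M -> R) : R :=
  inf [set d | achievable N K r d].

End PIRPSI.

(* Main.v *)
(** The converse fixes the prefetch map [i |-> i] and peels off the messages
    [K-1, K-2, ..., 0] one at a time.  Given the cache and the messages already
    peeled, the answers for demand [k] reveal the uncached part of [W_k], up to the
    decoding error; privacy makes each single-database answer independent of the
    demand, so passing to the next demand costs a factor [N].  All entropies are
    averages over the query vector of entropies under uniform messages.

    For achievability, every message is cut into blocks indexed by the keys
    [v : 'I_K -> 'I_N], each block holding symbols [1, ..., N-1] and a virtual
    symbol [0] equal to zero.  For a uniformly random permutation [s] of the keys,
    database [n] is asked, for every key [u], for the sum over [k] of the symbol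
    [v k] of block [s u] of message [k], where [v] is [u] with [n] added in
    coordinate [th]: as [n] varies only the desired symbol changes, and it takes
    the value [0] once.  Database [n] sees a uniform permutation whatever [th] is.
    The requested sums whose keys are supported on [m] cached messages are known to
    the user, so a Vandermonde code compresses the [N^K] answers to [N^K - N^m]
    without knowing which ones these are.  Repeating this along the messages, with
    [m] decreasing as the cached prefixes end, gives the claimed cost. *)
Require Import Defs.
From HB Require Import structures.
From mathcomp Require Import all_boot all_order all_fingroup all_algebra.
From mathcomp Require Import all_classical all_reals all_analysis.
From mathcomp Require Import ring lra zify.
Set Implicit Arguments. Unset Strict Implicit. Unset Printing Implicit Defensive.
Import Order.TTheory GRing.Theory Num.Theory numFieldNormedType.Exports.
Local Open Scope ring_scope.

(** * Entropy *)

Section Entropy.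
Context {R : realType} {T : finType}.
Variable P : T -> R.

Lemma eq_ent {U V : eqType} (f : T -> U) (g : T -> V) :
  (forall t t', (f t == f t') = (g t == g t')) -> ent P f = ent P g.
Proof.
move=> fg; congr (- _); apply: eq_bigr => t _; congr (_ * ln _).
by apply: eq_bigl => t'; rewrite fg.
Qed.

Hypothesis P_ge0 : forall t, 0 <= P t.

Lemma prob_of_gt0 {U : eqType} (f : T -> U) t : 0 < P t -> 0 < prob_of P f (f t).
Proof.
move=> Pt; rewrite /prob_of (bigD1 t) //= ltr_wpDr //.
by apply: sumr_ge0.
Qed.

Lemma le_ent {U V : eqType} (f : T -> U) (g : T -> V) :
  (forall t t', f t = f t' -> g t = g t') -> ent P g <= ent P f.
Proof.
move=> fg; rewrite lerN2; apply: ler_sum => t _.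
have [->|Pt0] := eqVneq (P t) 0; first by rewrite !mul0r ?(addr0, subr0, oppr0).
have Pt : 0 < P t by rewrite lt0r Pt0 P_ge0.
rewrite ler_pM2l // ler_ln ?posrE ?prob_of_gt0 //.
rewrite /prob_of [leRHS](bigID (fun t' => f t' == f t)) /=.
rewrite [X in _ <= X + _](eq_bigl (fun t' => f t' == f t)); last first.
  by move=> t' /=; apply: andb_idl => /eqP/fg ->.
by rewrite lerDl sumr_ge0.
Qed.

Lemma sum_ln_le (x : T -> R) : (forall t, 0 < P t -> 0 < x t) ->
  \sum_t P t * ln (x t) <= \sum_t P t * x t - \sum_t P t.
Proof.
move=> x_gt0; rewrite -sumrB; apply: ler_sum => t _.
rewrite -[X in _ - X]mulr1 -mulrBr.
have [->|Pt0] := eqVneq (P t) 0; first by rewrite !mul0r ?(addr0, subr0, oppr0).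
have Pt : 0 < P t by rewrite lt0r Pt0 P_ge0.
rewrite ler_pM2l // -{1}[x t](subrKC 1) le_ln1Dx //.
by have := x_gt0 t Pt; lra.
Qed.

(** [A] lies in one fibre of [f], so this is part of the mass of that fibre over its whole mass; a
    null fibre gives [0], as division by zero is zero. *)
Lemma sum_div_prob_of_le1 {U : eqType} (f : T -> U) (A : pred T) :
  (forall t t', A t -> A t' -> f t = f t') ->
  \sum_(t | A t) P t / prob_of P f (f t) <= 1.
Proof.
move=> Af; have [t0 At0|A0] := pickP A; last first.
  by rewrite big_pred0 // ler01.
rewrite (eq_bigr (fun t => P t / prob_of P f (f t0))); last first.
  by move=> t At; rewrite (Af t t0).
rewrite -mulr_suml.
have s_le : \sum_(t | A t) P t <= prob_of P f (f t0).
  rewrite /prob_of [leRHS](bigID A) /=.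
  rewrite [X in _ <= X + _](eq_bigl A); last first.
    by move=> t /=; apply: andb_idl => /Af/(_ At0)/eqP.
  by rewrite lerDl sumr_ge0.
have p_ge0 : 0 <= prob_of P f (f t0) by apply: sumr_ge0.
move: p_ge0; rewrite le_eqVlt => /orP[/eqP <-|p_gt0].
  by rewrite invr0 mulr0 ler01.
by rewrite ler_pdivrMr // mul1r.
Qed.

(** Expand the mass of [(f, h)] over [t1] and that of [(g, h)] over [t2], then sum over [t] first:
    for fixed [t1] and [t2], the remaining [t] share one value of [(f, g, h)] and contribute at most
    1. *)
Lemma sum_prob_ratio_le {U V W : eqType} (f : T -> U) (g : T -> V) (h : T -> W) :
  \sum_t P t * (prob_of P (fun t => (f t, h t)) (f t, h t)
    * prob_of P (fun t => (g t, h t)) (g t, h t)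
    / (prob_of P (fun t => (f t, g t, h t)) (f t, g t, h t) * prob_of P h (h t)))
  <= \sum_t P t.
Proof.
pose fh t := (f t, h t); pose gh t := (g t, h t); pose fgh t := (f t, g t, h t).
rewrite -[X in X <= _]/(\sum_t P t * (prob_of P fh (fh t) * prob_of P gh (gh t)
    / (prob_of P fgh (fgh t) * prob_of P h (h t)))).
have p_ge0 (X : eqType) (k : T -> X) u : 0 <= prob_of P k u by apply: sumr_ge0.
under eq_bigr => t _.
  have -> : P t * (prob_of P fh (fh t) * prob_of P gh (gh t)
    / (prob_of P fgh (fgh t) * prob_of P h (h t))) =
    prob_of P fh (fh t) * (P t / prob_of P fgh (fgh t) * prob_of P gh (gh t)
      / prob_of P h (h t)) by rewrite invfM; ring.
  rewrite {1}/prob_of mulr_suml.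
  over.
rewrite (exchange_big_dep xpredT) //=; apply: ler_sum => t1 _.
rewrite -mulr_sumr -[leRHS]mulr1 ler_wpM2l //.
rewrite (eq_bigr (fun t => P t / prob_of P fgh (fgh t) * prob_of P gh (gh t)
    / prob_of P h (h t1))); last by move=> t /eqP[_ ->].
rewrite -mulr_suml.
have s_le : \sum_(t | fh t1 == fh t) P t / prob_of P fgh (fgh t) * prob_of P gh (gh t)
    <= prob_of P h (h t1).
  under eq_bigr => t _ do rewrite [X in _ * X]/prob_of mulr_sumr.
  rewrite (exchange_big_dep (fun t2 => h t2 == h t1)) /=; last first.
    by move=> t t2 /eqP[_ ->] /eqP[_ ->].
  apply: ler_sum => t2 _.
  rewrite -mulr_suml -[leRHS]mul1r ler_wpM2r //.
  apply: sum_div_prob_of_le1 => t t' /andP[/eqP[ft ht] /eqP[gt _]].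
  by move=> /andP[/eqP[ft' ht'] /eqP[gt' _]]; rewrite /fgh -ft -ft' -gt -gt' -ht -ht'.
have := p_ge0 _ h (h t1); rewrite le_eqVlt => /orP[/eqP <-|p_gt0].
  by rewrite invr0 mulr0 ler01.
by rewrite ler_pdivrMr // mul1r.
Qed.

(** Conditional mutual information is nonnegative: [ln x <= x - 1] applied to the ratio of the
    preceding bound. *)
Lemma ent_submodular {U V W : eqType} (f : T -> U) (g : T -> V) (h : T -> W) :
  ent P (fun t => (f t, g t, h t)) + ent P h <=
  ent P (fun t => (f t, h t)) + ent P (fun t => (g t, h t)).
Proof.
rewrite /ent -!opprD lerN2 -!big_split /= -subr_le0 -sumrB.
set fgh := fun t => (f t, g t, h t).
set fh := fun t => (f t, h t).
set gh := fun t => (g t, h t).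
have := sum_prob_ratio_le f g h; rewrite -subr_le0; apply: le_trans.
apply: le_trans (sum_ln_le _); last first.
  by move=> t Pt; rewrite divr_gt0 ?mulr_gt0 ?(prob_of_gt0 fh) ?(prob_of_gt0 gh)
    ?(prob_of_gt0 fgh) ?(prob_of_gt0 h).
apply: ler_sum => t _.
have [->|Pt0] := eqVneq (P t) 0; first by rewrite !mul0r ?(addr0, subr0, oppr0).
have Pt : 0 < P t by rewrite lt0r Pt0 P_ge0.
have fh0 := prob_of_gt0 fh Pt; have gh0 := prob_of_gt0 gh Pt.
have fgh0 := prob_of_gt0 fgh Pt; have h0 := prob_of_gt0 h Pt.
rewrite -/(fgh t) -/(fh t) -/(gh t).
by rewrite ln_div ?lnM ?posrE ?mulr_gt0 //; lra.
Qed.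

Lemma cent_le_cent {U V W : eqType} (f : T -> U) (g : T -> V) (h : T -> W) :
  (forall t t', g t = g t' -> h t = h t') -> cent P f g <= cent P f h.
Proof.
move=> gh; rewrite /cent.
have := ent_submodular f g h.
rewrite (@eq_ent _ _ (fun t => (f t, g t, h t)) (fun t => (f t, g t))); last first.
  move=> t t'; rewrite !xpair_eqE -andbA; congr (_ && _).
  by apply: andb_idr => /eqP/gh ->.
rewrite (@eq_ent _ _ (fun t => (g t, h t)) g); last first.
  by move=> t t'; rewrite !xpair_eqE; apply: andb_idr => /eqP/gh ->.
by lra.
Qed.

Lemma cent_ge0 {U V : eqType} (f : T -> U) (g : T -> V) : 0 <= cent P f g.
Proof. by rewrite subr_ge0 le_ent // => t t' [_ ->]. Qed.

Lemma cent_eq0 {U V : eqType} (f : T -> U) (g : T -> V) :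
  (forall t t', 0 < P t -> 0 < P t' -> g t = g t' -> f t = f t') -> cent P f g = 0.
Proof.
move=> gf; apply/eqP; rewrite subr_eq0; apply/eqP; congr (- _).
apply: eq_bigr => t _.
have [->|Pt0] := eqVneq (P t) 0; first by rewrite !mul0r ?(addr0, subr0, oppr0).
have Pt : 0 < P t by rewrite lt0r Pt0 P_ge0.
congr (_ * ln _); rewrite /prob_of.
rewrite [RHS](bigID (fun t' => f t' == f t)) /= [X in _ + X]big1 ?addr0.
  by apply: eq_bigl => t'; rewrite xpair_eqE andbC.
move=> t' /andP[/eqP gt ft]; apply/le_anti; rewrite P_ge0 andbT leNgt.
by apply/negP => Pt'; move: ft; rewrite (gf t' t) // eqxx.
Qed.

(* Chain rule for [H(f, e | g)], expanded in both orders. *)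
Lemma cent_exchange {U V W : eqType} (f : T -> U) (e : T -> V) (g : T -> W) :
  cent P f g = cent P e g - cent P e (fun t => (f t, g t))
    + cent P f (fun t => (e t, g t)).
Proof.
rewrite /cent (@eq_ent _ _ (fun t => (f t, (e t, g t))) (fun t => (e t, (f t, g t)))).
  by ring.
by move=> t t'; rewrite !xpair_eqE andbCA.
Qed.

Lemma cent_seq_le {I U : finType} {V : eqType} (s : seq I) (f : I -> T -> U) (g : T -> V) :
  cent P (fun t => [seq f i t | i <- s]) g <= \sum_(i <- s) cent P (f i) g.
Proof.
elim: s => [|i s IH].
  rewrite big_nil /= /cent (@eq_ent _ _ (fun t => ([::] : seq U, g t)) g) ?subrr //.
rewrite big_cons; apply: le_trans (lerD (lexx _) IH).
have := @ent_submodular _ _ _ (f i) (fun t => [seq f i t | i <- s]) g.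
rewrite /cent (@eq_ent _ _ (fun t => ([seq f i t | i <- i :: s], g t))
  (fun t => (f i t, [seq f i t | i <- s], g t))) //; by lra.
Qed.

Hypothesis P_sum1 : \sum_t P t = 1.

Lemma ent_const {U : eqType} (u : U) : ent P (fun=> u) = 0.
Proof.
rewrite /ent big1 ?oppr0 // => t _.
by rewrite /prob_of (eq_bigl xpredT) ?P_sum1 ?ln1 ?mulr0 // => t'; rewrite eqxx.
Qed.

Lemma cent_const {U V : eqType} (f : T -> U) (v : V) : cent P f (fun=> v) = ent P f.
Proof.
rewrite /cent ent_const subr0; apply: eq_ent => t t'.
by rewrite xpair_eqE eqxx andbT.
Qed.

Lemma cent_le_ent {U V : eqType} (f : T -> U) (g : T -> V) : cent P f g <= ent P f.
Proof. by rewrite -(cent_const f tt); apply: cent_le_cent. Qed.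

Lemma ent_le_ln_card {U : finType} (f : T -> U) : ent P f <= ln #|U|%:R.
Proof.
have U_gt0 : (0 < #|U|)%N.
  have [t _|T0] := pickP (@predT T); first by apply/card_gt0P; exists (f t).
  by move: P_sum1; rewrite big_pred0 // => /esym/eqP; rewrite oner_eq0.
have n_gt0 : 0 < #|U|%:R :> R by rewrite ltr0n.
rewrite -subr_le0 /ent -[X in _ - X]mul1r -[X in _ - X * _]P_sum1 mulr_suml.
rewrite -opprD -big_split /= -sumrN.
have le0 : \sum_t P t * (prob_of P f (f t) * #|U|%:R)^-1 - \sum_t P t <= 0.
  rewrite subr_le0 P_sum1.
  under eq_bigr => t _ do rewrite invfM mulrA.
  rewrite -mulr_suml ler_pdivrMr // mul1r (partition_big f xpredT) //=.
  rewrite -sum1_card natr_sum; apply: ler_sum => u _.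
  by apply: sum_div_prob_of_le1 => t t' /eqP -> /eqP ->.
apply: le_trans le0; apply: le_trans (sum_ln_le _); last first.
  by move=> t Pt; rewrite invr_gt0 mulr_gt0 // prob_of_gt0.
apply: ler_sum => t _.
have [->|Pt0] := eqVneq (P t) 0; first by rewrite !mul0r ?(addr0, subr0, oppr0).
have Pt : 0 < P t by rewrite lt0r Pt0 P_ge0.
have p0 := prob_of_gt0 f Pt.
by rewrite lnV ?lnM ?posrE ?mulr_gt0 // mulrN mulrDr.
Qed.

End Entropy.

(** * Chain rule for product laws *)

Section ProductEntropy.
Context {R : realType} {T1 T2 : finType}.
Variables (P1 : T1 -> R) (P2 : T2 -> R).
Hypotheses (P1_ge0 : forall x, 0 <= P1 x) (P2_ge0 : forall y, 0 <= P2 y).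
Hypothesis P1_sum1 : \sum_x P1 x = 1.

Let P (t : T1 * T2) := P1 t.1 * P2 t.2.

Lemma prob_of_prod_snd {U : eqType} (h : T1 * T2 -> U) x y :
  (forall t t', h t = h t' -> t.2 = t'.2) ->
  prob_of P h (h (x, y)) = prob_of P1 (fun x => h (x, y)) (h (x, y)) * P2 y.
Proof.
move=> h2; rewrite /prob_of mulr_suml.
rewrite (reindex_onto (fun x' => (x', y)) fst) /=; last first.
  by move=> [x' y'] /eqP/h2 /= ->.
by apply: eq_bigl => x'; rewrite eqxx andbT.
Qed.

(** Since [h] reveals the second coordinate, its probabilities factor and the logarithm splits. *)
Lemma ent_prod_snd {U : eqType} (h : T1 * T2 -> U) :
  (forall t t', h t = h t' -> t.2 = t'.2) ->
  ent P h = - (\sum_y P2 y * ln (P2 y)) + \sum_y P2 y * ent P1 (fun x => h (x, y)).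
Proof.
move=> h2; rewrite /ent.
under [X in _ = _ + X]eq_bigr do rewrite mulrN.
rewrite [X in _ = _ + X]sumrN -opprD -big_split /=; congr (- _).
transitivity (\sum_x \sum_y P (x, y) * ln (prob_of P h (h (x, y)))).
  by rewrite pair_big; apply: eq_bigr => -[].
rewrite exchange_big /=; apply: eq_bigr => y _.
rewrite -[X in X + _]mul1r -P1_sum1 mulr_suml mulr_sumr -big_split /=.
apply: eq_bigr => x _; rewrite prob_of_prod_snd // /P /=.
have [->|Px0] := eqVneq (P1 x) 0; first by rewrite !(mul0r, mulr0) addr0.
have [->|Py0] := eqVneq (P2 y) 0; first by rewrite !(mul0r, mulr0) addr0.
have Px : 0 < P1 x by rewrite lt0r Px0 P1_ge0.
have Py : 0 < P2 y by rewrite lt0r Py0 P2_ge0.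
rewrite lnM ?posrE ?(prob_of_gt0 P1_ge0 (fun x => h (x, y)) Px) //.
by ring.
Qed.

Lemma cent_prod_snd {U V : eqType} (f : T1 * T2 -> U) (g : T1 * T2 -> V) :
  (forall t t', g t = g t' -> t.2 = t'.2) ->
  cent P f g =
  \sum_y P2 y * cent P1 (fun x => f (x, y)) (fun x => g (x, y)).
Proof.
move=> g2; rewrite /cent !ent_prod_snd //; last by move=> t t' [_ /g2].
rewrite opprD addrACA subrr add0r -sumrB.
by apply: eq_bigr => y _; rewrite mulrBr.
Qed.

End ProductEntropy.

(** * Converse *)

Section Converse.
Context {R : realType} {N K M L q : nat}.
Variables (r : 'I_M -> R) (sch : scheme R N K M L q).
Hypotheses (N_gt0 : (0 < N)%N) (q_gt1 : (1 < q)%N).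
Hypotheses (sch_valid : valid_qdist sch) (sch_private : private sch).

Definition unifW (w : msgs K L q) : R := (q ^ (K * L))%:R^-1.

Lemma unifW_ge0 w : 0 <= unifW w. Proof. by rewrite invr_ge0. Qed.

Lemma card_msgs : #|{: msgs K L q}| = (q ^ (K * L))%N.
Proof. by rewrite !card_ffun !card_ord -expnM mulnC. Qed.

Lemma unifW_sum1 : \sum_w unifW w = 1.
Proof.
rewrite sumr_const card_msgs -[LHS]mulr_natl divff //.
by rewrite pnatr_eq0 -lt0n expn_gt0 ltnW.
Qed.

Lemma ent_unifW_inj {U : eqType} (f : msgs K L q -> U) : injective f ->
  ent unifW f = (K * L)%:R * ln q%:R.
Proof.
move=> f_inj; rewrite /ent.
rewrite (eq_bigr (fun w => unifW w * - ((K * L)%:R * ln q%:R))); last first.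
  move=> w _; congr (_ * _); rewrite /prob_of (big_pred1 w); last first.
    by move=> w'; rewrite /= (inj_eq f_inj).
  by rewrite /unifW lnV ?natrX ?posrE ?exprn_gt0 ?ltr0n 1?ltnW //
    lnXn ?ltr0n 1?ltnW // mulr_natl.
by rewrite -mulr_suml unifW_sum1 mul1r opprK.
Qed.

Lemma msgs_inhabited : msgs K L q.
Proof. exact: [ffun=> [ffun=> Ordinal (ltnW q_gt1)]]. Qed.

(** Messages are uniform and independent of the queries, so privacy at one fixed message tuple, with
    the answer it forces, already equates the laws of the query [Q n]. *)
Lemma private_marginal n th th' (H H' : {ffun 'I_M -> 'I_K}) (g : Qt sch -> R) :
  injectiveb H -> injectiveb H' ->
  \sum_Q qdist th H Q * g (Q n) = \sum_Q qdist th' H' Q * g (Q n).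
Proof.
move=> H_inj H'_inj.
have law th1 (H1 : {ffun 'I_M -> 'I_K}) x :
    \sum_(Q : {ffun 'I_N -> Qt sch} | Q n == x) qdist th1 H1 Q =
    (q ^ (K * L))%:R * prob_of (jointP (sch := sch) th1 H1)
      (fun t => (t.2 n, answer n t, t.1)) (x, ans n x msgs_inhabited, msgs_inhabited).
  rewrite /prob_of (reindex_onto (fun Q => (msgs_inhabited, Q)) snd) /=; last first.
    by move=> [w Q] /= /eqP[_ _ ->].
  rewrite mulr_sumr; apply: eq_big => Q.
    rewrite !xpair_eqE /answer /= !eqxx !andbT.
    by case: eqP => // ->; rewrite eqxx.
  move=> _; rewrite /jointP mulrA divff ?mul1r //.
  by rewrite pnatr_eq0 -lt0n expn_gt0 ltnW.
have push th1 (H1 : {ffun 'I_M -> 'I_K}) :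
    \sum_(Q : {ffun 'I_N -> Qt sch}) qdist th1 H1 Q * g (Q n) =
    \sum_x (\sum_(Q : {ffun 'I_N -> Qt sch} | Q n == x) qdist th1 H1 Q) * g x.
  rewrite (partition_big (fun Q : {ffun 'I_N -> Qt sch} => Q n) xpredT) //=.
  by apply: eq_bigr => x _; rewrite mulr_suml; apply: eq_bigr => Q /eqP ->.
by rewrite !push; apply: eq_bigr => x _; rewrite !law (sch_private n th th' H_inj H'_inj).
Qed.

Definition all_answers (Q : {ffun 'I_N -> Qt sch}) (w : msgs K L q) :
  {ffun 'I_N -> At sch} := [ffun n => ans n (Q n) w].

(** With the queries frozen and averaged outside, this is the conditional entropy of all answers
    given [g] and the queries. *)
Definition avg_cent th H {U : eqType} (g : msgs K L q -> U) : R :=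
  \sum_Q qdist th H Q * cent unifW (all_answers Q) g.

Definition avg_cent1 th H n {U : eqType} (g : msgs K L q -> U) : R :=
  \sum_Q qdist th H Q * cent unifW (ans n ((Q : {ffun 'I_N -> Qt sch}) n)) g.

Lemma avg_cent1_le th (H : {ffun 'I_M -> 'I_K}) n {U : eqType} (g : msgs K L q -> U) :
  injectiveb H -> avg_cent1 th H n g <= avg_cent th H g.
Proof.
move=> /(sch_valid th)[Q_ge0 _]; apply: ler_sum => Q _; rewrite ler_wpM2l //.
rewrite lerD2r; apply: le_ent; first exact: unifW_ge0.
by move=> w w' [/ffunP/(_ n)]; rewrite !ffunE => -> ->.
Qed.

Lemma avg_cent_le_sum th (H : {ffun 'I_M -> 'I_K}) {U : eqType} (g : msgs K L q -> U) :
  injectiveb H -> avg_cent th H g <= \sum_n avg_cent1 th H n g.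
Proof.
move=> /(sch_valid th)[Q_ge0 _]; rewrite exchange_big /=; apply: ler_sum => Q _.
rewrite -mulr_sumr ler_wpM2l // -big_enum /=.
apply: le_trans (cent_seq_le unifW_ge0 _ _ _).
rewrite lerD2r; apply: le_ent; first exact: unifW_ge0.
move=> w w' [/eq_in_map e ->]; congr (_, _); apply/ffunP => n.
by rewrite !ffunE; apply: e; rewrite mem_enum.
Qed.

(* Privacy makes the single-database terms independent of the demand, so that
   changing the demand costs at most a factor [N]. *)
Lemma avg_cent_change_demand th th' (H H' : {ffun 'I_M -> 'I_K}) {U : eqType}
    (g : msgs K L q -> U) :
  injectiveb H -> injectiveb H' -> N%:R^-1 * avg_cent th' H' g <= avg_cent th H g.
Proof.
move=> H_inj H'_inj; rewrite ler_pdivrMl ?ltr0n //.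
apply: le_trans (avg_cent_le_sum _ _ H'_inj) _.
rewrite mulr_natl -[X in _ *+ X]card_ord -sumr_const; apply: ler_sum => n _.
apply: le_trans (avg_cent1_le _ n _ H_inj).
by rewrite /avg_cent1 (private_marginal n th' th (fun x => cent unifW (ans n x) g) H'_inj H_inj).
Qed.

(** Dropping the conditioning on [g] and on the queries only increases the entropy of each
    answer. *)
Lemma avg_cent_le_download th th' (H H' : {ffun 'I_M -> 'I_K}) {U : eqType}
    (g : msgs K L q -> U) :
  injectiveb H -> injectiveb H' -> avg_cent th H g <= download sch th' H'.
Proof.
move=> H_inj H'_inj; apply: le_trans (avg_cent_le_sum _ _ H_inj) _.
apply: ler_sum => n _.
rewrite /avg_cent1 (private_marginal n th th' (fun x => cent unifW (ans n x) g) H_inj H'_inj).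
have [Q_ge0 Q_sum1] := sch_valid th' H'_inj.
have P_ge0 t : 0 <= jointP (sch := sch) th' H' t by rewrite mulr_ge0 ?invr_ge0.
have P_sum1 : \sum_t jointP (sch := sch) th' H' t = 1.
  rewrite -[RHS]mul1r -{1}unifW_sum1 -Q_sum1 big_distrlr pair_big /=.
  by apply: eq_bigr.
apply: le_trans (cent_le_ent P_ge0 P_sum1 _ (fun t => t.2)).
rewrite (@cent_prod_snd _ _ _ unifW (qdist th' H') unifW_ge0 Q_ge0 unifW_sum1) //.
apply: ler_sum => Q _; rewrite ler_wpM2l //.
rewrite (cent_const unifW_sum1) /answer /=.
exact: (cent_le_ent unifW_ge0 unifW_sum1 (ans n (Q n)) g).
Qed.

Definition cacheW (H : {ffun 'I_M -> 'I_K}) (w : msgs K L q) : {ffun 'I_M -> seq 'I_q} :=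
  [ffun i => take (ncache L r i) (fgraph (w (H i)))].

Lemma decoding_error_avg th (H : {ffun 'I_M -> 'I_K}) : injectiveb H ->
  decoding_error r sch th H =
  \sum_Q qdist th H Q * cent unifW (fun w => w th)
    (fun w => (cacheW H w, Q, all_answers Q w)).
Proof.
move=> H_inj; have [Q_ge0 _] := sch_valid th H_inj.
rewrite /decoding_error.
rewrite (@cent_prod_snd _ _ _ unifW (qdist th H) unifW_ge0 Q_ge0 unifW_sum1) //.
by move=> t t' [].
Qed.

(** Messages past the first [M] get the default [0], so that the converse can sum over all of
    ['I_K]. *)
Definition ncached (k : nat) : nat :=
  if insub k is Some i then ncache L r (i : 'I_M) else 0%N.

Hypothesis leMK : (M <= K)%N.

Definition std_prefetch : {ffun 'I_M -> 'I_K} := [ffun i => widen_ord leMK i].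

Lemma std_prefetch_inj : injectiveb std_prefetch.
Proof. by apply/injectiveP => i j; rewrite !ffunE => /(congr1 val) /= /val_inj. Qed.

Definition last_msgs (m : nat) (w : msgs K L q) :=
  [ffun k : 'I_K => if (K - m <= k)%N then Some (w k) else None].

Definition known (m : nat) (w : msgs K L q) := (cacheW std_prefetch w, last_msgs m w).

(* Conditioning on everything except the uncached tail of message [k] leaves
   exactly that tail, by comparing with the full entropy [K * L * ln q]. *)
Lemma cent_msg_ge (k : 'I_K) (m : nat) : (k < K - m)%N ->
  (L - ncached k)%:R * ln q%:R <= cent unifW (fun w => w k) (known m).
Proof.
move=> k_lt.
pose keep := [pred x : 'I_K * 'I_L | (x.1 != k) || (x.2 < ncached k)%N].
pose G (w : msgs K L q) := [ffun x : {x | keep x} => w (val x).1 (val x).2].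
have G_other w w' : G w = G w' -> forall k', k' != k -> w k' = w' k'.
  move=> /ffunP e k' kk'; apply/ffunP => j.
  have kp : keep (k', j) by rewrite /= kk'.
  by have := e (Sub (k', j) kp); rewrite !ffunE SubK.
have G_pre w w' : G w = G w' ->
    take (ncached k) (fgraph (w k)) = take (ncached k) (fgraph (w' k)).
  move=> /ffunP e; pose z := Ordinal (ltnW q_gt1).
  have sz (v : {ffun 'I_L -> 'I_q}) : size (fgraph v) = L by rewrite size_tuple card_ord.
  apply: (@eq_from_nth _ z); first by rewrite !size_take !sz.
  move=> i; rewrite size_take sz => i_lt.
  have [i_nc i_L] : (i < ncached k)%N /\ (i < L)%N by case: ifP i_lt; lia.
  have nthv (v : {ffun 'I_L -> 'I_q}) : nth z (fgraph v) i = v (Ordinal i_L).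
    by have := nth_fgraph_ord z (Ordinal i_L) v; rewrite /=.
  rewrite !nth_take // !nthv.
  have kp : keep (k, Ordinal i_L) by rewrite /= i_nc orbT.
  by have := e (Sub (k, Ordinal i_L) kp); rewrite !ffunE SubK.
apply: (@le_trans _ _ (cent unifW (fun w => w k) G)); last first.
  apply: (cent_le_cent unifW_ge0) => w w' Gw; congr (_, _).
    apply/ffunP => i; rewrite !ffunE; have [ik|ik] := eqVneq (widen_ord leMK i) k.
      have -> : ncache L r i = ncached k.
        by rewrite /ncached -ik /= valK.
      by rewrite ik (G_pre _ _ Gw).
    by rewrite (G_other _ _ Gw).
  apply/ffunP => k'; rewrite !ffunE; case: ifP => // k'_ge.
  by rewrite (G_other _ _ Gw) //; apply: contraTneq k'_ge => ->; rewrite -ltnNge.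
rewrite /cent ent_unifW_inj; last first.
  move=> w w' [wk /G_other Gw]; apply/ffunP => k'.
  by have [->|/Gw] := eqVneq k' k.
(* The complement of [keep] contains the uncached positions of message [k]; since [G] has at most
   [q ^ #|keep|] values, the full entropy leaves at least their share. *)
have card_keep : (#|{: {x | keep x}}| + (L - ncached k) <= K * L)%N.
  rewrite card_sig.
  have -> : (K * L = #|{: 'I_K * 'I_L}|)%N by rewrite card_prod !card_ord.
  rewrite -(cardC keep) leq_add2l.
  have -> : (L - ncached k = #|[pred j : 'I_L | (ncached k <= j)%N]|)%N.
    rewrite -[LHS]muln1 -sum_nat_const_nat big_geq_mkord -sum1_card.
    by apply: eq_bigl => j; rewrite !inE.
  have pair_inj : injective (fun j : 'I_L => (k, j)) by move=> j j' [].
  rewrite -(fintype.card_image pair_inj).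
  apply: subset_leq_card; apply/fintype.subsetP => x /fintype.imageP[j]; rewrite !inE => jnc ->.
  by rewrite /= eqxx -leqNgt.
have := ent_le_ln_card unifW_ge0 unifW_sum1 G.
rewrite card_ffun card_ord natrX lnXn ?ltr0n 1?ltnW // -[_ *+ _]mulr_natl => G_le.
have lnq : 0 <= ln q%:R :> R by rewrite ln_ge0 // ler1n ltnW.
have : (#|{: {x | keep x}}| + (L - ncached k))%:R * ln q%:R <= (K * L)%:R * ln q%:R :> R.
  by rewrite ler_wpM2r // ler_nat.
by rewrite natrD; lra.
Qed.

(** Chain rule in both orders: message [k] has at least the entropy of its uncached tail before the
    answers are seen, and at most the decoding error after. *)
Lemma avg_cent_step (k : 'I_K) m : (k = K - m.+1 :> nat)%N -> (m < K)%N ->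
  (L - ncached k)%:R * ln q%:R - decoding_error r sch k std_prefetch
    + avg_cent k std_prefetch (known m.+1) <= avg_cent k std_prefetch (known m).
Proof.
move=> km m_lt.
have [Q_ge0 Q_sum1] := sch_valid k std_prefetch_inj.
rewrite decoding_error_avg ?std_prefetch_inj //.
set c := _ * ln _; rewrite -[c]mul1r -Q_sum1 mulr_suml -sumrB -big_split /=.
apply: ler_sum => Q _; rewrite -mulrBr -mulrDr ler_wpM2l //.
rewrite [leRHS](cent_exchange unifW _ (fun w => w k)).
apply: lerD; first apply: lerB.
- by apply: cent_msg_ge; lia.
- by apply: (cent_le_cent unifW_ge0) => w w' [-> -> _].
apply: (cent_le_cent unifW_ge0) => w w' [cw /ffunP lw].
rewrite /known cw; congr (_, (_, _)).
  by have := lw k; rewrite !ffunE km leqnn => -[].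
apply/ffunP => k'; have := lw k'; rewrite !ffunE.
by case: (leqP (K - m) k') => // h; rewrite (_ : (K - m.+1 <= k')%N) //; lia.
Qed.

Lemma download_ge th (H : {ffun 'I_M -> 'I_K}) : injectiveb H ->
  \sum_(k < K) N%:R^-1 ^+ (K - k.+1) *
    ((L - ncached k)%:R * ln q%:R - decoding_error r sch k std_prefetch)
  <= download sch th H.
Proof.
move=> H_inj.
pose x (k : 'I_K) := N%:R^-1 ^+ (K - k.+1) *
    ((L - ncached k)%:R * ln q%:R - decoding_error r sch k std_prefetch).
(* Invariant after peeling the last [m] messages. The demand [th'] stays free, since the induction
   hypothesis is applied at the next message to be peeled. *)
suff claim m th' : (m <= K)%N ->
    \sum_(k < K | (K - m <= k)%N) x k + N%:R^-1 ^+ m * avg_cent th' std_prefetch (known m)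
      <= download sch th H.
  apply: le_trans (claim K th (leqnn K)); rewrite subnn /= lerDl.
  rewrite mulr_ge0 ?exprn_ge0 ?invr_ge0 //.
  have [Q_ge0 _] := sch_valid th std_prefetch_inj.
  by apply: sumr_ge0 => Q _; rewrite mulr_ge0 // cent_ge0 //; exact: unifW_ge0.
elim: m th' => [|m IH] th' m_le.
  rewrite big_pred0 ?add0r ?mul1r; last by move=> k; rewrite subn0 leqNgt ltn_ord.
  exact: avg_cent_le_download std_prefetch_inj H_inj.
have k_lt : (K - m.+1 < K)%N by lia.
pose k := Ordinal k_lt.
apply: le_trans (IH k (ltnW m_le)).
rewrite (bigD1 k) /= ?leqnn // addrAC addrC; apply: lerD.
  rewrite le_eqVlt; apply/orP; left; apply/eqP; apply: eq_bigl => k'.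
  by rewrite -val_eqE /=; lia.
apply: le_trans (ler_wpM2l _ (avg_cent_step (erefl (nat_of_ord k)) m_le)); last first.
  by rewrite exprn_ge0 // invr_ge0.
rewrite mulrDr; apply: lerD.
  by rewrite /x /= (_ : K - (K - m.+1).+1 = m)%N //; lia.
rewrite exprSr -mulrA ler_wpM2l ?exprn_ge0 ?invr_ge0 //.
exact: avg_cent_change_demand std_prefetch_inj std_prefetch_inj.
Qed.

End Converse.

(** * Coded schemes *)

(** Equal encodings make [x - y] orthogonal to all polynomials of degree below [c], evaluated at the
    nodes. The one vanishing at all nodes outside [A] except that of [i0] isolates [x i0 - y i0]. *)
Lemma vandermonde_recover {F : fieldType} {I : finType} (al : I -> F) (A : {set I})
    (c : nat) (x y : I -> F) :
  injective al -> (#|~: A| <= c)%N -> {in A, x =1 y} ->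
  (forall j, (j < c)%N -> \sum_i x i * al i ^+ j = \sum_i y i * al i ^+ j) -> x =1 y.
Proof.
move=> al_inj Ac xy enc.
have poly0 (g : {poly F}) : (size g <= c)%N -> \sum_i (x i - y i) * g.[al i] = 0.
  move=> gc; under eq_bigr => i _ do rewrite horner_coef mulr_sumr.
  rewrite exchange_big big1 //= => j _.
  have := enc j (leq_trans (ltn_ord j) gc) => /(congr1 (fun z => g`_j * z)) /eqP.
  rewrite -subr_eq0 -mulrBr -sumrB mulr_sumr => /eqP e; rewrite -[RHS]e.
  by apply: eq_bigr => i _; ring.
move=> i0; have [/xy //|i0A] := boolP (i0 \in A).
pose g := \prod_(i in ~: A :\ i0) ('X - (al i)%:P).
have sg : (size g <= c)%N.
  rewrite /g -big_enum size_prod_XsubC -cardE.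
  by move: Ac; rewrite (cardsD1 i0) inE i0A.
have := poly0 g sg; rewrite (bigD1 i0) //= [X in _ + X]big1 ?addr0; last first.
  move=> i ii0; have [/xy ->|iA] := boolP (i \in A); first by rewrite subrr mul0r.
  rewrite (_ : g.[al i] = 0) ?mulr0 //; apply/eqP.
  rewrite horner_prod; apply/prodf_eq0; exists i; first by rewrite !inE ii0.
  by rewrite hornerXsubC subrr.
move/eqP; rewrite mulf_eq0 subr_eq0 => /orP[/eqP //|].
rewrite horner_prod => /prodf_eq0[i]; rewrite !inE => /andP[ii0 _].
by rewrite hornerXsubC subr_eq0 (inj_eq al_inj) eq_sym (negbTE ii0).
Qed.

(* A scheme for short messages [X -> F] without side information, whose database
   [n] returns one field element per index.  Given the messages in [A], at least
   [kappa #|A|] of these elements are already determined; the Vandermonde code of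
   [coded_scheme] saves that many symbols. *)
Record base_scheme (R : realType) (F : fieldType) (N K : nat) (X : finType)
    (kappa : nat -> nat) := BaseScheme {
  base_query : finType;
  base_index : finType;
  base_dist : 'I_K -> {ffun 'I_N -> base_query} -> R;
  base_sym : 'I_N -> base_query -> base_index -> ('I_K -> X -> F) -> F;
  base_dist_ge0 : forall th Q, 0 <= base_dist th Q;
  base_dist_sum1 : forall th, \sum_Q base_dist th Q = 1;
  base_dist_marginal : forall (n : 'I_N) (th th' : 'I_K) x,
    \sum_(Q : {ffun 'I_N -> base_query} | Q n == x) base_dist th Q =
    \sum_(Q : {ffun 'I_N -> base_query} | Q n == x) base_dist th' Q;
  base_decode : forall th (Q : {ffun 'I_N -> base_query}) W W', 0 < base_dist th Q ->
    (forall n i, base_sym n (Q n) i W = base_sym n (Q n) i W') -> W th =1 W' th;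
  base_local : forall n x (A : {set 'I_K}), exists2 B : {set base_index},
    (kappa #|A| <= #|B|)%N & forall W W', (forall k, k \in A -> W k =1 W' k) ->
      {in B, forall i, base_sym n x i W = base_sym n x i W'} }.

Lemma take_fgraph_inj {L : nat} {T : eqType} (n : nat) (v v' : {ffun 'I_L -> T}) (j : 'I_L) :
  take n (fgraph v) = take n (fgraph v') -> (j < n)%N -> v j = v' j.
Proof.
move=> e jn; have := congr1 (fun s => nth (v j) s j) e.
by rewrite !nth_take // !nth_fgraph_ord.
Qed.

(** * Compression of a base scheme, repeated over blocks *)

Section Compressed.
Context {R : realType} {p N K M : nat} {X : finType} {kappa : nat -> nat}.
Hypothesis p_prime : prime p.
Variables (bs : base_scheme R 'F_p N K X kappa) (r : 'I_M -> R) (B : nat).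
Hypothesis index_le : (#|base_index bs| <= p)%N.

Local Notation L := (B * #|X|)%N.

Definition node (i : base_index bs) : 'F_p := (enum_rank i)%:R.

Lemma node_inj : injective node.
Proof.
move=> i j /(congr1 val) /=; rewrite !val_Fp_nat // !modn_small.
- by move=> /val_inj/enum_rank_inj.
- exact: leq_trans (ltn_ord _) index_le.
- exact: leq_trans (ltn_ord _) index_le.
Qed.

Definition to_field : 'I_p -> 'F_p := cast_ord (esym (Fp_cast p_prime)).

Lemma to_field_inj : injective to_field. Proof. exact: cast_ord_inj. Qed.

Lemma block_pos_subproof (b : 'I_B) (x : X) : (b * #|X| + enum_rank x < L)%N.
Proof.
apply: (@leq_trans (b.+1 * #|X|)); last by rewrite leq_mul2r ltn_ord orbT.
by rewrite mulSn addnC ltn_add2r ltn_ord.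
Qed.

Definition block_pos b x : 'I_L := Ordinal (block_pos_subproof b x).

Lemma block_pos_surj (j : 'I_L) : exists b x, j = block_pos b x.
Proof.
have X_gt0 : (0 < #|X|)%N.
  by have := leq_ltn_trans (leq0n _) (ltn_ord j); rewrite muln_gt0 => /andP[].
have b_lt : (j %/ #|X| < B)%N by rewrite ltn_divLR.
have x_lt : (j %% #|X| < #|X|)%N by rewrite ltn_mod.
exists (Ordinal b_lt), (enum_val (Ordinal x_lt)); apply: val_inj => /=.
by rewrite enum_valK /= -divn_eq.
Qed.

Definition block (w : msgs K L p) (b : 'I_B) (k : 'I_K) (x : X) : 'F_p :=
  to_field (w k (block_pos b x)).

(** Ranks in the prefetch list are recorded instead of messages, so that [block_len], and with it
    the answer format, does not depend on the private [H]. *)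
Definition block_cached (b : 'I_B) : {set 'I_M} :=
  [set i | (b.+1 * #|X| <= ncache L r i)%N].

Definition block_len (b : 'I_B) : nat := (#|base_index bs| - kappa #|block_cached b|)%N.

(* The same query serves all [B] blocks; only the compression varies with the
   number of messages whose block is entirely cached. *)
Definition coded_scheme : scheme R N K M L p :=
  @Scheme R N K M L p (base_query bs)
    {ffun {b : 'I_B & 'I_(block_len b)} -> 'F_p}
    (fun th _ Q => base_dist th Q)
    (fun n x w => [ffun bj => \sum_i base_sym n x i (block w (tag bj))
      * node i ^+ (nat_of_ord (tagged bj))]).

Lemma coded_scheme_valid : valid_qdist coded_scheme.
Proof.
by move=> th H _; split; [exact: base_dist_ge0|exact: base_dist_sum1].
Qed.

Lemma coded_scheme_private : private coded_scheme.
Proof.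
move=> n th th' H H' _ _ [[x a] w].
have law th1 H1 : prob_of (jointP (sch := coded_scheme) th1 H1)
    (fun t => (t.2 n, answer n t, t.1)) (x, a, w) =
    if ans (s := coded_scheme) n x w == a then
      (p ^ (K * L))%:R^-1 * \sum_(Q : {ffun 'I_N -> base_query bs} | Q n == x) base_dist th1 Q
    else 0.
  rewrite /prob_of (reindex_onto (fun Q => (w, Q)) snd) /=; last first.
    by move=> [w' Q] /= /eqP[_ _ ->].
  case: ifP => e.
    rewrite mulr_sumr; apply: eq_bigl => Q.
    rewrite !xpair_eqE /answer /= !eqxx !andbT.
    by have [->|] //= := eqVneq (Q n) x; rewrite e.
  rewrite big_pred0 // => Q; rewrite !xpair_eqE /answer /= !eqxx !andbT.
  by have [->|] //= := eqVneq (Q n) x; rewrite e.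
by rewrite !law (base_dist_marginal n th th').
Qed.

Lemma coded_scheme_decodes th (H : {ffun 'I_M -> 'I_K}) : injectiveb H ->
  decoding_error r coded_scheme th H = 0.
Proof.
move=> H_injb; have [Q_ge0 _] := coded_scheme_valid th H_injb.
have /injectiveP H_inj := H_injb.
have c_gt0 : 0 < (p ^ (K * L))%:R^-1 :> R by rewrite invr_gt0 ltr0n expn_gt0 prime_gt0.
apply: cent_eq0 => [t|t t'].
  by rewrite mulr_ge0 ?invr_ge0.
rewrite /jointP !pmulr_rgt0 // => Qt_gt0 _ [/ffunP e_cache eQ /ffunP e_ans].
apply/ffunP => j; have [b [x ->]] := block_pos_surj j.
apply: to_field_inj; rewrite -!/(block _ _ _ _).
apply: (base_decode Qt_gt0) => n.
(* The determined symbols [S] vary with the query and with [H], but the code needs only a bound on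
   the number of the others. Injectivity of [H] gives [A] the size of [block_cached b]. *)
pose A := [set H i | i in block_cached b].
have [S S_card S_loc] := @base_local _ _ _ _ _ _ bs n (t.2 n) A.
apply: (vandermonde_recover node_inj (A := S) (c := block_len b)).
- by rewrite cardsCs finset.setCK leq_sub2l // -(card_imset _ H_inj).
- apply: S_loc => k /imsetP[i]; rewrite inE => i_cached -> x'.
  congr to_field; have := e_cache i; rewrite !ffunE => /take_fgraph_inj; apply.
  apply: leq_trans i_cached => /=.
  by rewrite mulSn addnC ltn_add2r ltn_ord.
move=> k k_lt; have /ffunP := e_ans n; rewrite !ffunE /answer /= -eQ.
move=> /(_ (Tagged (fun b => 'I_(block_len b)) (Ordinal k_lt))).
by rewrite !ffunE.
Qed.

Lemma coded_scheme_download th (H : {ffun 'I_M -> 'I_K}) : injectiveb H ->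
  download coded_scheme th H <= (N * \sum_b block_len b)%:R * ln p%:R.
Proof.
move=> H_inj; have [Q_ge0 Q_sum1] := coded_scheme_valid th H_inj.
have p_gt1 := prime_gt1 p_prime.
have P_ge0 t : 0 <= jointP (sch := coded_scheme) th H t by rewrite mulr_ge0 ?invr_ge0.
have P_sum1 : \sum_t jointP (sch := coded_scheme) th H t = 1.
  rewrite -[RHS]mul1r -{1}(@unifW_sum1 R K L p p_gt1) -Q_sum1 big_distrlr pair_big /=.
  by apply: eq_bigr.
rewrite natrM -mulrA mulr_natl -[X in _ *+ X]card_ord -sumr_const; apply: ler_sum => n _.
apply: le_trans (ent_le_ln_card P_ge0 P_sum1 _) _.
rewrite card_ffun card_Fp // card_tagged sumnE big_map big_enum /=.
rewrite natrX lnXn ?ltr0n 1?ltnW // -[_ *+ _]mulr_natl.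
by under eq_bigr do rewrite card_ord.
Qed.

End Compressed.

(** * The base scheme for at least two databases *)

Section PermutedKeys.
Context {R : realType} {F : fieldType} {N' K : nat}.
Local Notation N := N'.+2.

Local Notation key := {ffun 'I_K -> 'I_N}.

Definition shift_key (n : 'I_N) (th : 'I_K) (v : key) : key :=
  [ffun k => if k == th then v k + n else v k].

Lemma shift_key_inj n th : injective (shift_key n th).
Proof.
apply: (can_inj (g := shift_key (- n) th)) => v; apply/ffunP => k.
rewrite !ffunE; case: eqP => // _; exact: addrK.
Qed.

Definition shift_perm n th : {perm key} := perm (@shift_key_inj n th).

(** Permutations compose from left to right, so database [n] uses block [s u] at the key
    [shift_key n th u]: the block is common to all databases. *)
Definition key_queries th (s : {perm key}) : {ffun 'I_N -> {perm key}} :=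
  [ffun n => ((shift_perm n th)^-1 * s)%g].

Lemma key_queries_shift th s n u : key_queries th s n (shift_key n th u) = s u.
Proof.
have -> : shift_key n th u = shift_perm n th u by rewrite permE.
by rewrite ffunE permM permK.
Qed.

Definition key_dist th (Q : {ffun 'I_N -> {perm key}}) : R :=
  \sum_(s | key_queries th s == Q) #|{perm key}|%:R^-1.

(* Symbol [0] of a block is zero; symbol [j + 1] is the stored symbol [j]. *)
Definition ext_msg (W : key * 'I_N'.+1 -> F) (b : key) (a : 'I_N) : F :=
  if unlift ord0 a is Some j then W (b, j) else 0.

Definition key_sym (n : 'I_N) (s : {perm key}) (v : key) (W : 'I_K -> key * 'I_N'.+1 -> F) :=
  \sum_k ext_msg (W k) (s v) (v k).

Lemma key_dist_ge0 th Q : 0 <= key_dist th Q.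
Proof. by apply: sumr_ge0 => s _; rewrite invr_ge0. Qed.

Lemma key_dist_sum1 th : \sum_Q key_dist th Q = 1.
Proof.
transitivity (\sum_(s : {perm key}) #|{perm key}|%:R^-1 : R).
  by rewrite [RHS](partition_big (key_queries th) xpredT).
rewrite sumr_const -[LHS]mulr_natl divff // pnatr_eq0 -lt0n.
by apply/card_gt0P; exists 1%g.
Qed.

(** Left translation in the permutation group is bijective, so exactly one [s] yields the query [x],
    whatever [th] is. *)
Lemma key_dist_marginal n th x :
  \sum_(Q : {ffun 'I_N -> {perm key}} | Q n == x) key_dist th Q = #|{perm key}|%:R^-1.
Proof.
transitivity (\sum_(s | key_queries th s n == x) #|{perm key}|%:R^-1 : R).
  rewrite (partition_big (key_queries th) (fun Q => Q n == x)) //=.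
  apply: eq_bigr => Q /eqP Qx; apply: eq_bigl => s.
  by rewrite andb_idl // => /eqP ->; rewrite Qx.
rewrite (big_pred1 (shift_perm n th * x)%g) // => s /=; rewrite ffunE.
by apply/eqP/eqP => [<-|->]; rewrite ?mulKVg ?mulKg.
Qed.

Lemma key_decode th (Q : {ffun 'I_N -> {perm key}}) W W' : 0 < key_dist th Q ->
  (forall n v, key_sym n (Q n) v W = key_sym n (Q n) v W') -> W th =1 W' th.
Proof.
move=> Q_gt0 symQ [b j].
have [s /eqP sQ|noS] := pickP [pred s | key_queries th s == Q]; last first.
  by move: Q_gt0; rewrite /key_dist big_pred0 ?ltxx.
pose u := (s^-1)%g b.
have sym_shift n V : key_sym n (Q n) (shift_key n th u) V =
    ext_msg (V th) b (u th + n) + \sum_(k | k != th) ext_msg (V k) b (u k).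
  rewrite /key_sym -sQ key_queries_shift /u permKV (bigD1 th) //= ffunE eqxx.
  by congr (_ + _); apply: eq_bigr => k /negbTE kth; rewrite ffunE kth.
(* The two databases are those whose shift brings the desired coordinate to [j + 1] and to [0]; the
   other messages cancel in the difference. *)
have sub V : V th (b, j) =
    key_sym (lift ord0 j - u th) (Q (lift ord0 j - u th)) (shift_key (lift ord0 j - u th) th u) V
    - key_sym (- u th) (Q (- u th)) (shift_key (- u th) th u) V.
  rewrite !sym_shift subrKC subrr /ext_msg liftK.
  by rewrite (_ : unlift ord0 0 = None) ?add0r ?addrK //; apply: unlift_none.
by rewrite !sub !symQ.
Qed.

(** A key equal to [0] outside [A] asks the other messages only for their zero symbol; there are
    [N ^ #|A|] such keys. *)
Lemma key_local (n : 'I_N) (s : {perm key}) (A : {set 'I_K}) : exists2 B : {set key},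
  (N ^ #|A| <= #|B|)%N & forall W W', (forall k, k \in A -> W k =1 W' k) ->
    {in B, forall v, key_sym n s v W = key_sym n s v W'}.
Proof.
exists [set v in pffun_on ord0 (mem A) predT].
  by rewrite cardsE card_pffun_on card_ord.
move=> W W' WA v; rewrite inE => /pffun_onP[/fintype.subsetP supp _].
apply: eq_bigr => k _; rewrite /ext_msg; case: unliftP => [j vk|//].
by rewrite WA //; apply: supp; rewrite inE vk.
Qed.

Definition permuted_keys : base_scheme R F N K (key * 'I_N'.+1)%type (expn N) :=
  BaseScheme key_dist_ge0 key_dist_sum1
    (fun n th th' x => etrans (key_dist_marginal n th x) (esym (key_dist_marginal n th' x)))
    key_decode key_local.

(** A geometric sum, the block size being [N^K (N - 1)]. *)
Lemma permuted_keys_rate m : (m <= K)%N ->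
  (N * (#|base_index permuted_keys| - N ^ m))%:R =
  #|{: key * 'I_N'.+1}|%:R * \sum_(j < K - m) N%:R^-1 ^+ j :> R.
Proof.
move=> mK; rewrite /= card_prod !card_ffun !card_ord.
rewrite !natrM natrB ?leq_exp2l // !natrX.
have N0 : N%:R != 0 :> R by rewrite pnatr_eq0.
have -> : N'.+1%:R = N%:R - 1 :> R by rewrite -[N in RHS]addn1 natrD addrK.
have geo := subrX1 (N%:R^-1 : R) (K - m).
have NN : N%:R ^+ K = N%:R ^+ m * N%:R ^+ (K - m) :> R by rewrite -exprD subnKC.
have inv : N%:R ^+ (K - m) * N%:R^-1 ^+ (K - m) = 1 :> R by rewrite -exprMn divff ?expr1n.
set S := \sum_(j < _) _ in geo *; set x := N%:R in geo NN inv N0 *.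
have -> : x ^+ K * (x - 1) * S = - (x ^+ K * x * ((x^-1 - 1) * S)) by field.
rewrite -geo NN mulrBr mulrBr; set a := x ^+ m; set b := x ^+ (K - m) in inv *.
have -> : a * b * x * x^-1 ^+ (K - m) = a * x * (b * x^-1 ^+ (K - m)) by ring.
by rewrite inv; ring.
Qed.

End PermutedKeys.

(** * The base scheme for one database *)

Section SingleDatabase.
Context {R : realType} {F : fieldType} {K : nat}.

Lemma big_ffun1_unit (G : {ffun 'I_1 -> unit} -> R) (P : pred {ffun 'I_1 -> unit}) :
  P [ffun=> tt] -> \sum_(Q | P Q) G Q = G [ffun=> tt].
Proof.
move=> Ptt; have all_tt (Q : {ffun 'I_1 -> unit}) : Q = [ffun=> tt].
  by apply/ffunP => n; rewrite ffunE; case: (Q n).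
by rewrite (big_pred1 [ffun=> tt]) // => Q; rewrite [Q]all_tt Ptt /= eqxx.
Qed.

(* For [N = 1] the blocks of [permuted_keys] are empty. *)
Definition single_database : base_scheme R F 1 K unit id.
Proof.
refine (@BaseScheme R F 1 K unit id unit 'I_K (fun _ _ => 1) (fun _ _ i W => W i tt) _ _ _ _ _).
- by move=> *; exact: ler01.
- by move=> th; rewrite big_ffun1_unit.
- by move=> n th th' [].
- by move=> th Q W W' _ e []; exact: (e ord0 th).
- by move=> n x A; exists A => // W W' WA i /WA ->.
Defined.

Lemma single_database_rate m : (m <= K)%N ->
  (1 * (#|base_index single_database| - m))%:R =
  #|{: unit}|%:R * \sum_(j < K - m) 1%:R^-1 ^+ j :> R.
Proof.
move=> _; rewrite mul1n card_unit mul1r /= card_ord invr1.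
under eq_bigr do rewrite expr1n.
by rewrite sumr_const card_ord.
Qed.

End SingleDatabase.

(** * Optimal cost *)

Section Cost.
Context {R : realType} {N K M : nat}.
Variable r : 'I_M -> R.
Hypothesis r01 : forall i, 0 <= r i <= 1.

Definition cached_frac (k : nat) : R := if insub k is Some i then r i else 0.

(** The target cost in the form that both bounds produce, one term per message. *)
Definition opt_cost : R :=
  \sum_(k < K) N%:R^-1 ^+ (K - k.+1) * (1 - cached_frac k).

Lemma ncached_le L k : (ncached (L := L) r k)%:R <= L%:R * cached_frac k.
Proof.
rewrite /ncached /cached_frac; case: insubP => [i _ _|_]; last by rewrite mulr0.
by rewrite truncn_le mulr_ge0 //; case/andP: (r01 i).
Qed.

Lemma uncached_ge L k : L%:R * (1 - cached_frac k) <= (L - ncached (L := L) r k)%:R.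
Proof.
have := ncached_le L k.
have : L%:R <= (L - ncached (L := L) r k)%:R + (ncached (L := L) r k)%:R :> R.
  by rewrite -natrD ler_nat; lia.
by lra.
Qed.

Lemma opt_costE : (M <= K)%N ->
  opt_cost = \sum_(j < K - M) N%:R^-1 ^+ j
    + \sum_(i < M) (1 - r i) * N%:R^-1 ^+ (K - i.+1).
Proof.
move=> MK.
have -> : opt_cost = \sum_(0 <= k < K) N%:R^-1 ^+ (K - k.+1) * (1 - cached_frac k).
  by rewrite big_mkord.
rewrite (big_cat_nat (leq0n M) MK) /= addrC; congr (_ + _).
  rewrite -[in LHS](add0n M) big_addn -(big_mkord xpredT (fun j => N%:R^-1 ^+ j)).
  rewrite [RHS]big_nat_rev /=; apply: eq_big_nat => j /andP[_ j_lt].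
  rewrite /cached_frac insubF ?subr0 ?mulr1; last by lia.
  by congr (_ ^+ _); lia.
rewrite big_mkord; apply: eq_bigr => i _.
by rewrite /cached_frac valK mulrC.
Qed.

Lemma geometric_sum_tail (x : R) m : (m <= K)%N ->
  \sum_(j < K - m) x ^+ j = \sum_(k < K | (m <= k)%N) x ^+ (K - k.+1).
Proof.
move=> mK; rewrite -(big_geq_mkord m K xpredT (fun k => x ^+ (K - k.+1))).
rewrite -[in RHS](add0n m) big_addn -(big_mkord xpredT (fun j => x ^+ j)).
rewrite [LHS]big_nat_rev /=; apply: eq_big_nat => j /andP[_ j_lt].
by congr (_ ^+ _); lia.
Qed.

End Cost.

(** [A] contains the initial segment ending at any of its members and lies inside the one ending
    just before any nonmember; compare cardinalities. *)
Lemma lower_set_ord {M : nat} (A : {set 'I_M}) :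
  (forall i j : 'I_M, (i <= j)%N -> j \in A -> i \in A) ->
  forall i, (i \in A) = (i < #|A|)%N.
Proof.
move=> lowA i.
have card_lt n : (n <= M)%N -> #|[set j : 'I_M | (j < n)%N]| = n.
  move=> nM; rewrite -sum1dep_card -(big_ord_widen M (fun=> 1%N) nM).
  by rewrite sum1_card card_ord.
have [iA|iA] := boolP (i \in A); apply/esym.
  rewrite -[X in (X <= _)%N](card_lt i.+1 (ltn_ord i)); apply: subset_leq_card.
  by apply/fintype.subsetP => j; rewrite inE ltnS => /lowA; apply.
apply/negbTE; rewrite -leqNgt -[X in (_ <= X)%N](card_lt i (ltnW (ltn_ord i))).
apply: subset_leq_card; apply/fintype.subsetP => j jA; rewrite inE ltnNge.
by apply: contra iA => /lowA; apply.
Qed.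

Lemma card_blocks_above (B x c : nat) : (0 < x)%N ->
  #|[set b : 'I_B | (c < b.+1 * x)%N]| = (B - c %/ x)%N.
Proof.
move=> x_gt0; rewrite -[RHS]muln1 -sum_nat_const_nat big_geq_mkord -sum1_card.
by apply: eq_bigl => b; rewrite inE /= -ltn_divLR // ltnS.
Qed.

(** * Download of the coded scheme *)

Section Achievability.
Context {R : realType} {p N K M : nat} {X : finType} {kappa : nat -> nat}.
Variables (bs : base_scheme R 'F_p N K X kappa) (r : 'I_M -> R).
Hypotheses (p_prime : prime p) (N_gt0 : (0 < N)%N) (leMK : (M <= K)%N).
Hypothesis r01 : forall i, 0 <= r i <= 1.
Hypothesis r_sorted : forall i j : 'I_M, (i <= j)%N -> r j <= r i.
Hypothesis index_le : (#|base_index bs| <= p)%N.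
Hypothesis X_gt0 : (0 < #|X|)%N.
Hypothesis rate : forall m, (m <= K)%N ->
  (N * (#|base_index bs| - kappa m))%:R =
  #|X|%:R * \sum_(j < K - m) N%:R^-1 ^+ j :> R.

Lemma mem_block_cached B b i :
  (i \in block_cached (X := X) r (B := B) b) = (i < #|block_cached (X := X) r b|)%N.
Proof.
apply: lower_set_ord => {}i j ij; rewrite !inE => /leq_trans; apply.
by apply: le_truncn; rewrite ler_wpM2l // r_sorted.
Qed.

(** The additive constant covers the rounding of the prefix length and the block in which the prefix
    ends; being independent of [B], it vanishes after normalization. *)
Lemma uncached_blocks_le B (k : nat) :
  #|[set b : 'I_B | (#|block_cached (X := X) r b| <= k)%N]|%:R
    <= B%:R * (1 - cached_frac r k) + 2 :> R.
Proof.
rewrite /cached_frac; case: insubP => [i _ <-|_]; last first.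
  rewrite subr0 mulr1; apply: (@le_trans _ _ B%:R); last by lra.
  by rewrite ler_nat -[leqRHS]card_ord max_card.
have -> : [set b : 'I_B | (#|block_cached (X := X) r b| <= i)%N] =
    [set b : 'I_B | (ncache (B * #|X|) r i < b.+1 * #|X|)%N].
  by apply/setP => b; rewrite !inE leqNgt -mem_block_cached inE -ltnNge.
rewrite card_blocks_above //.
have /andP[r_ge0 r_le1] := r01 i.
set c := ncache _ _ _; set x := #|X|.
have c_gt : (B * x)%:R * r i < c.+1%:R :> R.
  by case/andP: (truncn_itv (mulr_ge0 (ler0n R (B * x)) r_ge0)).
have c_lt : (c.+1 <= (c %/ x).+1 * x)%N by rewrite -ltn_divLR // ltnS.
have x_gt0 : 0 < x%:R :> R by rewrite ltr0n.
have Br : B%:R * r i < (c %/ x).+1%:R :> R.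
  rewrite -(ltr_pM2r x_gt0) -natrM.
  apply: lt_le_trans (_ : c.+1%:R <= _); last by rewrite ler_nat.
  by rewrite mulrAC -natrM.
have B_ge : B%:R * r i <= B%:R by rewrite -[leRHS]mulr1 ler_wpM2l.
have [cB|Bc] := leqP (c %/ x) B.
  by rewrite natrB //; move: Br; rewrite -addn1 natrD; lra.
by rewrite (_ : B - c %/ x = 0)%N; [lra|lia].
Qed.

(** By [rate], a block with [m] cached messages pays the terms of the messages [k >= m]. After
    exchanging the sums, message [k] is paid for in the blocks counted by [uncached_blocks_le]. *)
Lemma sum_block_len_le B :
  (N * \sum_(b < B) block_len bs r b)%:R <=
  #|X|%:R * (B%:R * opt_cost (N := N) (K := K) r
    + 2 * \sum_(k < K) N%:R^-1 ^+ (K - k.+1)) :> R.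
Proof.
rewrite big_distrr /= natr_sum.
have m_le b : (#|block_cached (X := X) r (B := B) b| <= K)%N.
  by apply: leq_trans leMK; rewrite -[leqRHS]card_ord max_card.
under eq_bigr => b _ do rewrite rate // geometric_sum_tail // big_mkcond.
rewrite -mulr_sumr ler_wpM2l // exchange_big /= /opt_cost !mulr_sumr -big_split /=.
apply: ler_sum => k _.
rewrite -big_mkcond /= sumr_const -[leLHS]mulr_natr.
have -> : B%:R * (N%:R^-1 ^+ (K - k.+1) * (1 - cached_frac r k)) + 2 * N%:R^-1 ^+ (K - k.+1)
  = N%:R^-1 ^+ (K - k.+1) * (B%:R * (1 - cached_frac r k) + 2) by ring.
rewrite ler_wpM2l ?exprn_ge0 ?invr_ge0 //.
by have := uncached_blocks_le B k; rewrite cardsE.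
Qed.

Lemma opt_cost_achievable : achievable N K r (opt_cost (N := N) (K := K) r).
Proof.
have p_gt1 := prime_gt1 p_prime.
(* The field stays fixed and only the number of blocks grows; [j.+1] keeps the messages nonempty. *)
exists (fun j => (j.+1 * #|X|)%N), (fun=> p), (fun j => coded_scheme p_prime bs r j.+1).
split=> //; split; [|split; [|split]].
- by move=> B; exists B => j Bj; apply: leq_trans (leq_pmulr _ X_gt0); lia.
- by move=> j; exact: coded_scheme_valid.
- by move=> j; exact: coded_scheme_private.
move=> th H H_inj; split.
  apply: cvg_near_cst; apply: nearW => j.
  by rewrite coded_scheme_decodes ?mul0r.
(* The converse at finite length already provides the lower half of the squeeze. *)
set c := opt_cost r.
pose s : R := 2 * \sum_(k < K) N%:R^-1 ^+ (K - k.+1).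
have lnp : 0 < ln p%:R :> R by rewrite ln_gt0 // ltr1n.
have X_gt0R : 0 < #|X|%:R :> R by rewrite ltr0n.
apply: (@squeeze_cvgr _ _ _ _ (fun=> c) (fun j => c + s * harmonic j)).
- apply: nearW => j.
  have L_gt0 : 0 < (j.+1 * #|X|)%:R * ln p%:R :> R by rewrite mulr_gt0 // ltr0n muln_gt0.
  apply/andP; split.
    rewrite ler_pdivlMr //.
    have valid : valid_qdist (coded_scheme p_prime bs r j.+1) by exact: coded_scheme_valid.
    have priv : private (coded_scheme p_prime bs r j.+1) by exact: coded_scheme_private.
    apply: le_trans (download_ge r N_gt0 p_gt1 valid priv leMK th H_inj).
    rewrite /c /opt_cost mulr_suml; apply: ler_sum => k _.
    rewrite coded_scheme_decodes ?std_prefetch_inj // subr0 -mulrA.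
    rewrite ler_wpM2l ?exprn_ge0 ?invr_ge0 // mulrA ler_wpM2r ?(ltW lnp) //.
    by rewrite mulrC uncached_ge.
  rewrite ler_pdivrMr //.
  apply: le_trans (coded_scheme_download _ _ _ _ _ H_inj) _.
  rewrite mulrA ler_wpM2r ?(ltW lnp) //.
  apply: le_trans (sum_block_len_le _) _; rewrite -/c -/s /harmonic natrM.
  rewrite le_eqVlt; apply/orP; left; apply/eqP => /=; field.
  by rewrite nat1r pnatr_eq0.
- exact: cvg_cst.
rewrite -[X in (_ --> X)%classic]addr0 -[X in (_ --> _ + X)%classic](mulr0 s).
by apply: cvgD; [exact: cvg_cst|apply: cvgM; [exact: cvg_cst|exact: cvg_harmonic]].
Qed.

End Achievability.

(** * Limit of the converse, and the theorem *)

Lemma achievable_ge {R : realType} {N K M : nat} (r : 'I_M -> R) (d : R) :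
  (0 < N)%N -> (0 < K)%N -> (M <= K)%N -> (forall i, 0 <= r i <= 1) ->
  achievable N K r d -> opt_cost (N := N) (K := K) r <= d.
Proof.
move=> N_gt0 K_gt0 leMK r01 [Ls [qs [sch [q_gt1 [L_oo [val [priv lims]]]]]]].
pose H := std_prefetch leMK.
have H_inj : injectiveb H := std_prefetch_inj leMK.
have [_ dl_cvg] := lims (Ordinal K_gt0) H H_inj.
pose e k j := decoding_error r (sch j) k H / ((Ls j)%:R * ln (qs j)%:R).
(* The finite-length converse after normalization; its error terms [e k j] tend to zero. *)
pose lb j : R := \sum_(k < K) N%:R^-1 ^+ (K - k.+1) * (1 - cached_frac r k - e k j).
have lb_cvg : (lb @ \oo --> opt_cost (N := N) (K := K) r)%classic.
  apply: cvg_big; first exact: add_continuous.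
  move=> k _; apply: cvgM; first exact: cvg_cst.
  rewrite -[X in (_ --> X)%classic]subr0; apply: cvgB; first exact: cvg_cst.
  by have [] := lims k H H_inj.
apply: ler_cvg_to lb_cvg dl_cvg _.
have [j0 Hj0] := L_oo 1%N.
exists j0 => // j /= j0j.
have lnq : 0 < ln (qs j)%:R :> R by rewrite ln_gt0 // ltr1n.
have L_gt0 : 0 < (Ls j)%:R * ln (qs j)%:R :> R by rewrite mulr_gt0 // ltr0n Hj0.
rewrite ler_pdivlMr //.
apply: le_trans (download_ge r N_gt0 (q_gt1 j) (val j) (priv j) leMK _ H_inj).
rewrite /lb mulr_suml; apply: ler_sum => k _.
rewrite -mulrA ler_wpM2l ?exprn_ge0 ?invr_ge0 // mulrBl divfK ?gt_eqF // lerB //.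
by rewrite mulrA ler_wpM2r ?(ltW lnq) // mulrC uncached_ge.
Qed.

(** There is no demand, so every condition on demands is vacuous. *)
Lemma achievable_no_message {R : realType} {N M : nat} (r : 'I_M -> R) (d : R) :
  achievable N 0 r d.
Proof.
exists id, (fun=> 2%N),
  (fun j => @Scheme R N 0 M j 2 unit unit (fun _ _ _ => 0) (fun _ _ _ => tt)).
split=> //; split; first by move=> B; exists B.
by split; [|split; [|]] => [j|j|] => [[]|n []|[]].
Qed.

Theorem theorem1 (R : realType) (N K M : nat) (S : R) (r : 'I_M -> R) :
  (1 <= N)%N ->
  0 <= S -> S <= M%:R -> (M <= K)%N ->
  (forall i, 0 <= r i <= 1) ->
  \sum_(i < M) r i = S ->
  (forall i j : 'I_M, (i <= j)%N -> r j <= r i) ->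
  Dstar N K r =
    \sum_(j < K - M) (N%:R ^-1) ^+ j
    + \sum_(i < M) (1 - r i) * (N%:R ^-1) ^+ (K - i.+1).
Proof.
move=> N_gt0 _ _ leMK r01 _ r_sorted; rewrite -opt_costE // /Dstar.
have [K_gt0|] := ltnP 0 K; last first.
  (* With no message the achievable set is all of [R]; its [inf] is then [0] by convention, matching
     the empty sum. *)
  rewrite leqn0 => /eqP K0; subst K.
  rewrite inf_out ?/opt_cost ?big_ord0 // => -[_ [b lb]].
  by have := lb (b - 1) (achievable_no_message r _); lra.
have opt_ach : achievable N K r (opt_cost (N := N) (K := K) r).
  case: N N_gt0 => [//|[|N']] N_gt0.
    (* In both cases the prime exceeds the number of requested symbols, so the code has enough
       distinct nodes. *)
    have [p p_gt p_prime] := prime_above K.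
    apply: (opt_cost_achievable (bs := @single_database R 'F_p K) p_prime) => //.
    - by rewrite /= card_ord ltnW.
    - by rewrite card_unit.
    - exact: single_database_rate.
  have [p p_gt p_prime] := prime_above #|{: {ffun 'I_K -> 'I_N'.+2}}|.
  apply: (opt_cost_achievable (bs := @permuted_keys R 'F_p N' K) p_prime) => //.
  - exact: ltnW.
  - by rewrite card_prod card_ffun !card_ord muln_gt0 expn_gt0.
  - exact: permuted_keys_rate.
have opt_lb : lbound [set d | achievable N K r d] (opt_cost (N := N) (K := K) r).
  by move=> d; exact: achievable_ge.
apply/le_anti/andP; split.
  by apply: ge_inf => //; exists (opt_cost (N := N) (K := K) r).
by apply: lb_le_inf => //; exists (opt_cost (N := N) (K := K) r).
Qed.
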